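(* For all $k,l,n,m\in\mathbb{Z}^+$, $|\mathsf{PTAB}(\mathsf{S4BP}^{k,l}_{n,m})|<\aleph_0$.
   Context: Tense formulas use $\Box$, $\Diamond=\neg\Box\neg$ and a past possibility operator written here $\mathsf{P}$; $\mathsf{S4}_t=\mathsf{K}_t\oplus\{\Box p\to p,\Box p\to\Box\Box p\}$. With $\Delta\phi=\phi\vee\Diamond\phi\vee\mathsf{P}\phi$, $\Delta^{j+1}\phi=\Delta\Delta^j\phi$: $\mathbf{bz}_l=\Delta^{l+1}p\to\Delta^lp$; $\mathbf{bw}^+_n=\bigwedge_{i\leq n}\Diamond p_i\to\bigvee_{i\neq j\leq n}\Diamond(p_i\wedge(p_j\vee\Diamond p_j))$; $\mathbf{bw}^-_m$ the same with $\mathsf{P}$ for $\Diamond$; $\mathbf{bd}_1=\Diamond\Box p_0\to p_0$, $\mathbf{bd}_{j+1}=\Diamond(\Box p_j\wedge\neg\mathbf{bd}_j)\to p_j$. $\mathsf{S4BP}^{k,l}_{n,m}=\mathsf{S4}_t\oplus\{\mathbf{bd}_k,\mathbf{bz}_l,\mathbf{bw}^+_n,\mathbf{bw}^-_m\}$ (depth $\le k$, z-degree $\le l$, forth-width $\le n$, back-width $\le m$). $\mathsf{PTAB}(L)$ is the set of pretabular logics (non-tabular, all consistent proper extensions tabular) extending $L$. *)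

(* Defs.v *)
From mathcomp Require Import all_boot.
From mathcomp Require Import boolp classical_sets functions cardinality.

Set Implicit Arguments.
Unset Strict Implicit.
Unset Printing Implicit Defensive.

Local Open Scope classical_set_scope.

Inductive form : Type :=
| Var of nat
| Bot
| Imp of form & form
| Box of form
| Pst of form.  (* past possibility *)

Definition Neg (a : form) : form := Imp a Bot.
Definition Top : form := Neg Bot.
Definition Or (a b : form) : form := Imp (Neg a) b.
Definition And (a b : form) : form := Neg (Imp a (Neg b)).
Definition Dia (a : form) : form := Neg (Box (Neg a)).

Fixpoint subst (s : nat -> form) (a : form) : form :=
  match a with
  | Var i => s i
  | Bot => Bot
  | Imp a b => Imp (subst s a) (subst s b)
  | Box a => Box (subst s a)
  | Pst a => Pst (subst s a)
  end.

(* Boolean evaluation in which variables, [Box]- and [Pst]-formulas are all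
   treated as atoms: [taut] holds exactly of the substitution instances of
   classical propositional tautologies. *)
Fixpoint beval (v : form -> bool) (a : form) : bool :=
  match a with
  | Bot => false
  | Imp a b => beval v a ==> beval v b
  | _ => v a
  end.

Definition taut : set form := [set a | forall v : form -> bool, beval v a].

(* The adjunction [Pst -| Box] subsumes the usual presentation of normal tense
   logics: it yields the K axioms and necessitation for [Box] and for the past
   box [Neg \o Pst \o Neg], replacement of equivalents under [Pst], and the
   axioms p -> Box (Pst p) and Pst (Box p) -> p. *)
Record tense_logic (L : set form) : Prop := TenseLogic {
  tl_taut : taut `<=` L;
  tl_mp : forall a b, L (Imp a b) -> L a -> L b;
  tl_subst : forall s a, L a -> L (subst s a);
  tl_adj : forall a b, L (Imp (Pst a) b) <-> L (Imp a (Box b))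
}.

Definition Kt : set form :=
  [set a | forall L, tense_logic L -> L a].

Definition oplus (L S : set form) : set form :=
  [set a | forall L', tense_logic L' -> L `<=` L' -> S `<=` L' -> L' a].

Fixpoint truth (W : Type) (R : W -> W -> Prop) (V : nat -> set W)
    (a : form) (x : W) : Prop :=
  match a with
  | Var i => V i x
  | Bot => False
  | Imp a b => truth R V a x -> truth R V b x
  | Box a => forall y, R x y -> truth R V a y
  | Pst a => exists2 y, R y x & truth R V a y
  end.

Definition Log (W : Type) (R : W -> W -> Prop) : set form :=
  [set a | forall (V : nat -> set W) (x : W), truth R V a x].

Definition tabular (L : set form) : Prop :=
  exists (W : finType) (R : rel W), 0 < #|W| /\ L = Log R.

Definition consistent (L : set form) : Prop := ~ L Bot.

(* Consistency of [L] itself is not demanded.  As frames are nonempty, the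
   inconsistent logic satisfies this definition vacuously; it contributes at
   most one element to [PTAB L0]. *)
Definition pretabular (L : set form) : Prop :=
  [/\ tense_logic L, ~ tabular L &
      forall L', tense_logic L' -> consistent L' -> L `<` L' -> tabular L'].

Definition PTAB (L0 : set form) : set (set form) :=
  [set L | pretabular L /\ L0 `<=` L].

Definition S4t : set form :=
  oplus Kt [set Imp (Box (Var 0)) (Var 0);
                Imp (Box (Var 0)) (Box (Box (Var 0)))].

Definition Delta (a : form) : form := Or a (Or (Dia a) (Pst a)).

Definition bz (l : nat) : form :=
  Imp (iter l.+1 Delta (Var 0)) (iter l Delta (Var 0)).

Definition bw (D : form -> form) (n : nat) : form :=
  Imp (\big[And/Top]_(i < n.+1) D (Var i))
      (\big[Or/Bot]_(i < n.+1) \big[Or/Bot]_(j < n.+1 | i != j)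
         D (And (Var i) (Or (Var j) (D (Var j))))).

Definition bw_fwd : nat -> form := bw Dia.
Definition bw_bwd : nat -> form := bw Pst.

(* Only meaningful for 0 < k; the value at 0 is junk. *)
Fixpoint bd (k : nat) : form :=
  match k with
  | 0 => Bot
  | j.+1 => if j is 0 then Imp (Dia (Box (Var 0))) (Var 0)
            else Imp (Dia (And (Box (Var j)) (Neg (bd j)))) (Var j)
  end.

Definition S4BP (k l n m : nat) : set form :=
  oplus S4t [set bd k; bz l; bw_fwd n; bw_bwd m].

(* Main.v *)
(** A connected S4-frame of depth at most [k], widths at most [n] and [m] and
    z-degree at most [l] has at most [N = (k (n + m)) ^ l] clusters: each level
    of [R(x)] (resp. [R^-1(x)]) meets at most [n] (resp. [m]) clusters.  In the
    canonical model over finitely many variables a cluster is moreover finite,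
    since its points are told apart by their variables; hence every logic above
    S4BP has the finite model property with respect to frames obtained from a
    preorder on at most [N] points by replacing each point with a nonempty
    finite cluster.  If such a logic [L] is not tabular, the size of some
    cluster [c] over some preorder [r] is unbounded, and shrinking all the other
    clusters yields [L <= L(r, c)], the logic of the frames in which only [c]
    is enlarged.  As [L(r, c)] is consistent and not tabular, a pretabular [L]
    equals [L(r, c)], and there are finitely many pairs [(r, c)]. *)
From HB Require Import structures.
Require Import Defs.
From mathcomp Require Import all_boot.
From mathcomp Require Import boolp classical_sets functions cardinality.

Set Implicit Arguments.
Unset Strict Implicit.
Unset Printing Implicit Defensive.

Local Open Scope classical_set_scope.

(** * Sets of formulas that respect the Boolean connectives *)

(** Shared by the formulas true at a point of a model and by maximal consistent theories, so that
    the connectives are analysed once for both. *)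
Definition boolean (T : set form) : Prop :=
  ~ T Bot /\ forall a b, T (Imp a b) <-> (T a -> T b).

Section Boolean.
Variables (T : set form) (bT : boolean T).

Lemma boolean_Imp a b : T (Imp a b) <-> (T a -> T b).
Proof. exact: bT.2. Qed.

Lemma boolean_Neg a : T (Neg a) <-> ~ T a.
Proof.
have [n0 bI] := bT; rewrite bI; split=> h Ta; first exact/n0/h.
by case: (h Ta).
Qed.

Lemma boolean_And a b : T (And a b) <-> T a /\ T b.
Proof.
rewrite boolean_Neg boolean_Imp boolean_Neg; split=> [h|[Ta Tb] /(_ Ta)//].
by split; apply: contrapT => nT; apply: h => // Ta.
Qed.

Lemma boolean_Or a b : T (Or a b) <-> T a \/ T b.
Proof.
rewrite boolean_Imp boolean_Neg; split=> [h|[//|//]].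
by have [|/h] := EM (T a); [left|right].
Qed.

Lemma boolean_bigAnd (n : nat) (P : pred 'I_n) F :
  T (\big[And/Top]_(i < n | P i) F i) <-> forall i, P i -> T (F i).
Proof.
have -> : (forall i, P i -> T (F i)) <->
    (forall i, i \in index_enum 'I_n -> P i -> T (F i)).
  by split=> h i; [move=> _; exact: h | apply: h; rewrite mem_index_enum].
elim: (index_enum _) => [|j s IH].
  by rewrite big_nil; split=> // _; apply/boolean_Neg; exact: bT.1.
rewrite big_cons; case: ifP => Pj; rewrite ?boolean_And IH; split.
- by move=> [Tj h] i; rewrite inE => /orP[/eqP->//|/h].
- by move=> h; split=> [|i si]; apply: h; rewrite // inE ?eqxx // si orbT.
- by move=> h i; rewrite inE => /orP[/eqP->|/h//]; rewrite Pj.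
- by move=> h i si; apply: h; rewrite inE si orbT.
Qed.

Lemma boolean_bigOr (n : nat) (P : pred 'I_n) F :
  T (\big[Or/Bot]_(i < n | P i) F i) <-> exists2 i, P i & T (F i).
Proof.
have -> : (exists2 i, P i & T (F i)) <->
    (exists i, [/\ i \in index_enum 'I_n, P i & T (F i)]).
  by split=> [[i Pi Ti]|[i [_ Pi Ti]]]; exists i; rewrite ?mem_index_enum.
elim: (index_enum _) => [|j s IH].
  by rewrite big_nil; split=> [/bT.1//|[? []]].
rewrite big_cons; case: ifP => Pj; rewrite ?boolean_Or IH; split.
- move=> [Tj|[i [si Pi Ti]]]; first by exists j; rewrite inE eqxx.
  by exists i; rewrite inE si orbT.
- move=> [i []]; rewrite inE => /orP[/eqP->|si] Pi Ti; first by left.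
  by right; exists i.
- by move=> [i [si Pi Ti]]; exists i; rewrite inE si orbT.
- move=> [i []]; rewrite inE => /orP[/eqP->|si] Pi Ti; last by exists i.
  by rewrite Pj in Pi.
Qed.

Lemma boolean_taut a : taut a -> T a.
Proof.
move=> /(_ (fun b => `[< T b >])).
suff -> : beval (fun b => `[< T b >]) a = `[< T a >] by move/asboolP.
elim: a => [i||a IHa b IHb|a _|a _] //=.
  by apply/esym/asboolPn; exact: bT.1.
rewrite IHa IHb; apply/implyP/asboolP; rewrite boolean_Imp.
  by move=> h /asboolP/h/asboolP.
by move=> h /asboolP/h/asboolP.
Qed.

End Boolean.

(** * Frames, bounded morphisms and substitution *)

Section Frames.
Variables (W : Type) (R : W -> W -> Prop).

Lemma truth_boolean V x : boolean (fun a => truth R V a x).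
Proof. by split. Qed.

Lemma truth_Dia V a x :
  truth R V (Dia a) x <-> exists2 y, R x y & truth R V a y.
Proof.
rewrite (boolean_Neg (truth_boolean V x)).
split=> [h|[y xy ay] /(_ y xy)/(_ ay)//].
apply: contrapT => n; apply: h => y xy ay; apply: n; by exists y.
Qed.

Lemma truth_subst V s a x :
  truth R V (subst s a) x <-> truth R (fun i => truth R V (s i)) a x.
Proof.
elim: a x => [i||a IHa b IHb|a IHa|a IHa] x //=.
- by rewrite IHa IHb.
- by split=> h y /h /IHa.
- by split=> -[y yx /IHa ay]; exists y.
Qed.

Lemma tense_Log : tense_logic (Log R).
Proof.
split=> [a ta V x|a b ab ha V x|s a ha V x|a b].
- exact: (boolean_taut (truth_boolean V x)).
- exact/ab/ha.
- exact/truth_subst/ha.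
- split=> h V x; first by move=> ax y xy; apply: h; exists x.
  by move=> [y yx ay]; apply: h yx.
Qed.

(** Tense bounded morphisms have a back condition in each direction. They serve both for surjections
    and for embedding a component into a disjoint union. *)
Lemma truth_morphism (W' : Type) (R' : W' -> W' -> Prop) (f : W -> W') :
    (forall x y, R x y -> R' (f x) (f y)) ->
    (forall x z, R' (f x) z -> exists2 y, R x y & f y = z) ->
    (forall x z, R' z (f x) -> exists2 y, R y x & f y = z) ->
  forall V a x, truth R (fun i => f @^-1` V i) a x <-> truth R' V a (f x).
Proof.
move=> forth fut past V; elim=> [i||a IHa b IHb|a IHa|a IHa] x //=.
- by rewrite IHa IHb.
- split=> [h z /fut[y xy <-]|h y xy]; first exact/IHa/h.
  exact/IHa/h/forth.
- split=> [[y yx /IHa ay]|[z /past[y yx <-] /IHa ay]]; last by exists y.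
  by exists (f y) => //; apply: forth.
Qed.

End Frames.

Lemma Log_surj (W W' : Type) (R : W -> W -> Prop) (R' : W' -> W' -> Prop)
    (f : W -> W') :
    (forall x y, R x y <-> R' (f x) (f y)) -> (forall z, exists x, f x = z) ->
  Log R `<=` Log R'.
Proof.
move=> fR fs a Ra V z; have [x <-] := fs z.
apply/(@truth_morphism _ R) => [u v /fR//|u v|u v|]; last exact: Ra.
- by have [y <-] := fs v; move=> /fR; exists y.
- by have [y <-] := fs v; move=> /fR; exists y.
Qed.

Lemma subst_Var a : subst Var a = a.
Proof. by elim: a => //= [a -> b ->|a ->|a ->]. Qed.

Lemma subst_finite_support a :
  exists v, forall s, (forall i, i < v -> s i = Var i) -> subst s a = a.
Proof.
elim: a => [i||a [v hv] b [w hw]|a [v hv]|a [v hv]] /=.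
- by exists i.+1 => s; apply.
- by exists 0.
- exists (maxn v w) => s h; rewrite hv ?hw // => i iv; apply: h.
    by rewrite leq_max iv orbT.
  by rewrite leq_max iv.
- by exists v => s /hv->.
- by exists v => s /hv->.
Qed.

(** * Canonical frame of a normal set of formulas *)

(** A tense logic without closure under substitution: enough for the canonical frame, and preserved
    when only finitely many variables are kept. *)
Record normal (Lam : set form) : Prop := Normal {
  normal_taut : taut `<=` Lam;
  normal_mp : forall a b, Lam (Imp a b) -> Lam a -> Lam b;
  normal_adj : forall a b, Lam (Imp (Pst a) b) <-> Lam (Imp a (Box b))
}.

Ltac prove_taut :=
  let v := fresh "v" in
  intro v; rewrite /=;
  repeat match goal with
  | |- context [beval v ?a] => case: (beval v a)
  | |- context [v (Pst ?a)] => case: (v (Pst a))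
  | |- context [v (Box ?a)] => case: (v (Box a))
  end; done.

Section Canonical.
Variables (Lam : set form) (nL : normal Lam).

Let mp := normal_mp nL.
Let adj := normal_adj nL.

Lemma taut_mp a b : taut (Imp a b) -> Lam a -> Lam b.
Proof. by move=> /(normal_taut nL); exact: mp. Qed.

Lemma taut_mp2 a b c : taut (Imp a (Imp b c)) -> Lam a -> Lam b -> Lam c.
Proof. by move=> /taut_mp h /h; exact: mp. Qed.

Lemma Pst_Box a : Lam (Imp (Pst (Box a)) a).
Proof. by apply/adj/(normal_taut nL); prove_taut. Qed.

Lemma Box_Pst a : Lam (Imp a (Box (Pst a))).
Proof. by apply/adj/(normal_taut nL); prove_taut. Qed.

Lemma Imp_Pst a b : Lam (Imp a b) -> Lam (Imp (Pst a) (Pst b)).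
Proof.
move=> ab; apply/adj; move: ab (Box_Pst b); apply: taut_mp2; prove_taut.
Qed.

Lemma Pst_Bot a : Lam (Neg a) -> Lam (Neg (Pst a)).
Proof. by move=> na; apply/adj; move: na; apply: taut_mp; prove_taut. Qed.

Lemma Pst_Or a b : Lam (Imp (Pst (Or a b)) (Or (Pst a) (Pst b))).
Proof.
apply/adj.
have ha : Lam (Imp a (Box (Or (Pst a) (Pst b)))).
  by apply/adj/(normal_taut nL); prove_taut.
have hb : Lam (Imp b (Box (Or (Pst a) (Pst b)))).
  by apply/adj/(normal_taut nL); prove_taut.
by move: ha hb; apply: taut_mp2; prove_taut.
Qed.

(** By the counit of the adjunction, [Pst X] yields both [Imp a b] and [a], hence [b]; transposing
    gives axiom K. *)
Lemma Box_Imp a b : Lam (Imp (Box (Imp a b)) (Imp (Box a) (Box b))).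
Proof.
pose X := And (Box (Imp a b)) (Box a).
have h1 : Lam (Imp (Pst X) (Imp a b)).
  have : Lam (Imp (Pst X) (Pst (Box (Imp a b)))).
    by apply: Imp_Pst; apply: (normal_taut nL); prove_taut.
  by move: (Pst_Box (Imp a b)); apply: taut_mp2; prove_taut.
have h2 : Lam (Imp (Pst X) a).
  have : Lam (Imp (Pst X) (Pst (Box a))).
    by apply: Imp_Pst; apply: (normal_taut nL); prove_taut.
  by move: (Pst_Box a); apply: taut_mp2; prove_taut.
have : Lam (Imp (Pst X) b) by move: h1 h2; apply: taut_mp2; prove_taut.
by move/adj; apply: taut_mp; prove_taut.
Qed.

Lemma nec a : Lam a -> Lam (Box a).
Proof.
move=> ha; have : Lam (Imp Top (Box a)).
  by apply/adj; move: ha; apply: taut_mp; prove_taut.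
by apply: taut_mp; prove_taut.
Qed.

Definition theory (G : set form) : Prop :=
  Lam `<=` G /\ forall a b, G (Imp a b) -> G a -> G b.

(** A Boolean set containing [Lam] is a maximal [Lam]-consistent theory. *)
Definition world : Type := {x : set form | boolean x /\ Lam `<=` x}.
HB.instance Definition _ := gen_eqMixin world.
HB.instance Definition _ := gen_choiceMixin world.

Definition holds (x : world) : form -> Prop := sval x.
Coercion holds : world >-> Funclass.

Lemma world_boolean (x : world) : boolean (holds x).
Proof. exact: (svalP x).1. Qed.

Lemma world_Lam (x : world) : Lam `<=` holds x.
Proof. exact: (svalP x).2. Qed.

Lemma world_ext (x y : world) : (forall a, x a <-> y a) -> x = y.
Proof.
case: x y => x hx [y hy] xy; apply: eq_exist.
by apply/seteqP; split=> a /xy.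
Qed.

Lemma theory_Imp (G : set form) b : theory G -> theory [set a | G (Imp b a)].
Proof.
move=> [LG mpG]; split=> [a La|a c] /=.
  by apply: LG; move: La; apply: taut_mp; prove_taut.
move=> bac ba; move: ba; apply: (mpG); move: bac; apply: (mpG); apply: LG.
by apply: (normal_taut nL); prove_taut.
Qed.

(** Zorn's lemma gives a theory maximal among the extensions of [G] that omit [a]; this maximality
    makes it Boolean. *)
Lemma lindenbaum (G : set form) a :
  theory G -> ~ G a -> exists2 x : world, G `<=` holds x & ~ x a.
Proof.
move=> tG Ga.
(* The empty set is admitted because Zorn_bigcup also takes the union of the
   empty chain. *)
pose P (X : set form) := X = set0 \/ [/\ theory X, G `<=` X & ~ X a].
have LT : Lam Top by apply: (normal_taut nL); prove_taut.
have [F FP Ftot|A [PA maxA]] := @Zorn_bigcup form P.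
  have [F0|/existsNP[X /not_implyP[FX X0]]] := EM (forall X, F X -> X = set0).
    by left; rewrite -subset0 => b [X /F0->].
  right; have [//|[tX GX Xa]] := FP X FX.
  have ne Y c : F Y -> Y c -> [/\ theory Y, G `<=` Y & ~ Y a].
    by move=> /FP[->|].
  split.
  - split=> [b Lb|b c [Y FY Yb] [Z FZ Zc]].
      by exists X => //; apply: tX.1.
    have [YZ|ZY] := Ftot Y Z FY FZ.
      have [[_ mpZ] _ _] := ne Z _ FZ Zc.
      by exists Z => //; apply: mpZ (YZ _ Yb) Zc.
    have [[_ mpY] _ _] := ne Y _ FY Yb.
    by exists Y => //; apply: mpY Yb (ZY _ Zc).
  - by move=> b /GX Xb; exists X.
  - by move=> [Y FY Ya]; have [_ _] := ne Y _ FY Ya.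
have {PA} [tA GA Aa] : [/\ theory A, G `<=` A & ~ A a].
  have [A0|//] := PA.
  have AG : A `<` G by rewrite A0; split=> // /(_ Top (tG.1 _ LT)).
  by case: (maxA G AG); right; split=> // b.
have [LA mpA] := tA.
have tautA b c : taut (Imp b c) -> A b -> A c.
  by move=> /(normal_taut nL)/LA; exact: mpA.
(* The theory generated by [A] and [b] consists of the [c] with [A (Imp b c)]; if it omitted [a], it
   would contradict maximality. *)
have add b : ~ A b -> A (Imp b a).
  move=> Ab; apply: contrapT => Aba.
  apply: (maxA [set c | A (Imp b c)]); last first.
    right; split=> //; first exact: theory_Imp.
    by move=> c /GA; apply: tautA; prove_taut.
  split=> [c /=|h]; first by apply: tautA; prove_taut.
  apply/Ab/h => /=; apply: LA; apply: (normal_taut nL); prove_taut.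
have bA : boolean A.
  split=> [A0|b c].
    by apply: Aa; move: A0; apply: tautA; prove_taut.
  split=> [|bc]; first exact: mpA.
  apply: contrapT => Abc; have [Ab|Ab] := EM (A b).
    by apply: Abc; move: (bc Ab); apply: tautA; prove_taut.
  apply: Aa; move: (add _ Ab); apply: mpA; move: (add _ Abc).
  by apply: tautA; prove_taut.
by exists (exist _ A (conj bA LA)).
Qed.

Definition acc (x y : world) : Prop := forall a, x (Box a) -> y a.

(** Unit and counit of the adjunction let a single relation serve both modalities. *)
Lemma accP (x y : world) : acc x y <-> forall a, x a -> y (Pst a).
Proof.
split=> h a xa.
  apply: h; move: xa.
  exact/(boolean_Imp (world_boolean x))/world_Lam/Box_Pst.
by move: (h _ xa); apply/(boolean_Imp (world_boolean y))/world_Lam/Pst_Box.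
Qed.

Lemma world_Box (x : world) a : x (Box a) <-> forall y, acc x y -> y a.
Proof.
split=> [xa y|h]; first exact.
apply: contrapT => xa.
have tG : theory [set b | x (Box b)].
  split=> [b /nec/(@world_Lam x _)//|b c /= xbc xb].
  have /(@world_Lam x _) := Box_Imp b c.
  move/(boolean_Imp (world_boolean x))/(_ xbc).
  by move/(boolean_Imp (world_boolean x)); apply.
by have [y xy] := lindenbaum tG xa; apply; apply: h => b /xy.
Qed.

Lemma world_Dia (x : world) a : x (Dia a) <-> exists2 y, acc x y & y a.
Proof.
rewrite (boolean_Neg (world_boolean x)) world_Box.
split=> [h|[y xy ya] /(_ y xy)].
  apply: contrapT => n; apply: h => y xy.
  by apply/(boolean_Neg (world_boolean y)) => ya; apply: n; exists y.
by move/(boolean_Neg (world_boolean y)).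
Qed.

Lemma world_Pst (x : world) a : x (Pst a) <-> exists2 y, acc y x & y a.
Proof.
split=> [xa|[y /accP]]; last exact.
have bx := world_boolean x.
(* [G] collects what must be true at every predecessor of [x] satisfying [a]. *)
pose G := [set b | x (Neg (Pst (Neg (Imp a b))))].
have tG : theory G.
  split=> [b Lb|b c /= /(boolean_Neg bx) xb /(boolean_Neg bx) xc].
    by apply: world_Lam; apply: Pst_Bot; move: Lb; apply: taut_mp; prove_taut.
  apply/(boolean_Neg bx) => xac.
  have : Lam (Imp (Pst (Neg (Imp a c)))
                  (Pst (Or (Neg (Imp a (Imp b c))) (Neg (Imp a b))))).
    by apply: Imp_Pst; apply: (normal_taut nL); prove_taut.
  move/(@world_Lam x _)/(boolean_Imp bx)/(_ xac).
  have /(@world_Lam x _)/(boolean_Imp bx) h :=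
    Pst_Or (Neg (Imp a (Imp b c))) (Neg (Imp a b)).
  by move/h/(boolean_Or bx) => [].
have GBot : ~ G Bot.
  move/(boolean_Neg bx); apply; move: xa; apply/(boolean_Imp bx)/world_Lam.
  by apply: Imp_Pst; apply: (normal_taut nL); prove_taut.
have [y Gy _] := lindenbaum tG GBot; have bY := world_boolean y.
exists y.
  move=> c yc; apply: contrapT => xc.
  suff : G (Neg (Box c)) by move/Gy/(boolean_Neg bY); apply.
  apply/(boolean_Neg bx) => h; apply: xc.
  have /(@world_Lam x _)/(boolean_Imp bx) := Pst_Box c; apply.
  move: h; apply/(boolean_Imp bx)/world_Lam/Imp_Pst.
  by apply: (normal_taut nL); prove_taut.
apply: Gy; apply: world_Lam; apply: Pst_Bot.
by apply: (normal_taut nL); prove_taut.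
Qed.

Lemma world_boolean_subst s (x : world) : boolean (fun a => x (subst s a)).
Proof.
have [n0 bI] := world_boolean x; split=> // a b; exact: bI.
Qed.

(** Truth lemma for a family of worlds closed under successors and predecessors, with the valuation
    given by a substitution. *)
Lemma truth_world (C : Type) (h : C -> world) s :
    (forall c y, acc (h c) y -> exists c', h c' = y) ->
    (forall c y, acc y (h c) -> exists c', h c' = y) ->
  forall a c, truth (fun c c' => acc (h c) (h c')) (fun i c => h c (s i)) a c
    <-> h c (subst s a).
Proof.
move=> fut past; elim=> [i||a IHa b IHb|a IHa|a IHa] c //=.
- by split=> //; exact: (world_boolean _).1.
- by rewrite (boolean_Imp (world_boolean _)) IHa IHb.
- rewrite world_Box; split=> [H y cy|H c' /H/IHa//].
  by have [c' e] := fut _ _ cy; rewrite -e in cy *; exact/IHa/H.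
- rewrite world_Pst; split=> [[c' cc' /IHa ca]|[y yc ya]].
    by exists (h c').
  have [c' e] := past _ _ yc; rewrite -e in yc ya; exists c' => //.
  exact/IHa.
Qed.

Lemma separate (x : world) (e : seq world) :
  exists2 a, x a & forall y : world, y \in e -> y <> x -> ~ y a.
Proof.
elim: e => [|y e [a xa ea]].
  exists Top => //.
  exact/(boolean_Neg (world_boolean x))/(world_boolean x).1.
have [->|yx] := EM (y = x).
  by exists a => // z; rewrite inE => /orP[/eqP->|/ea].
have [b xb yb] : exists2 b, x b & ~ y b.
  apply: contrapT => n; apply: yx; apply: world_ext => b.
  have xy c : x c -> y c.
    by move=> xc; apply: contrapT => yc; apply: n; exists c.
  split=> [yb|/xy//]; apply: contrapT => /(boolean_Neg (world_boolean x))/xy.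
  by move/(boolean_Neg (world_boolean y)).
exists (And a b); first exact/(boolean_And (world_boolean x)).
move=> z ze zx /(boolean_And (world_boolean z))[za zb].
by move: ze zx; rewrite inE => /orP[/eqP zy|/ea ze /ze//]; rewrite zy in zb.
Qed.

(** Makes every valuation on finitely many worlds come from a substitution. *)
Lemma definable (U : set world) (e : seq world) :
  exists a, forall y : world, y \in e -> y a <-> U y.
Proof.
elim: e => [|x e [a ea]]; first by exists Bot.
have [b xb eb] := separate x e.
have bN (z : world) : z \in e -> z b -> z = x.
  by move=> /eb ze zb; apply: contrapT => /ze.
have [Ux|Ux] := EM (U x).
- exists (Or a b) => y; rewrite inE => /orP[/eqP->|ye].
    by split=> // _; apply/(boolean_Or (world_boolean x)); right.
  rewrite (boolean_Or (world_boolean y)) (ea _ ye).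
  by split=> [[//|/(bN _ ye)->//]|]; left.
- exists (And a (Neg b)) => y; rewrite inE => /orP[/eqP->|ye].
    split=> [|/Ux//] /(boolean_And (world_boolean x))[_].
    by move/(boolean_Neg (world_boolean x)).
  rewrite (boolean_And (world_boolean y)) (boolean_Neg (world_boolean y)).
  rewrite (ea _ ye).
  by split=> [[]//|Uy]; split=> // /(bN _ ye) yx; rewrite yx in Uy.
Qed.

(** For each pair some [a (i, j)] is boxed at [y i] and false at [y j]. With [b i] the conjunction
    of all [Box (a (i, j))] and [Neg (a (j, i))], incomparability passes to all worlds satisfying
    these formulas. *)
Lemma separate_antichain n (y : nat -> world) :
    (forall i j, i <= n -> j <= n -> i <> j -> ~ acc (y i) (y j)) ->
  exists2 b : nat -> form, (forall i, i <= n -> y i (b i)) &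
    forall i j z z', i <= n -> j <= n -> i <> j ->
      holds z (b i) -> holds z' (b j) -> ~ acc z z'.
Proof.
move=> anti.
have /choice[a ha] (p : nat * nat) : exists a, p.1 <= n -> p.2 <= n ->
    p.1 <> p.2 -> y p.1 (Box a) /\ ~ y p.2 a.
  apply: contrapT => h.
  have [p1n [p2n p12]] : p.1 <= n /\ p.2 <= n /\ p.1 <> p.2.
    by split; [|split]; apply: contrapT => c; apply: h; exists Bot.
  apply: (anti _ _ p1n p2n p12) => b yb; apply: contrapT => nb.
  by apply: h; exists b.
exists (fun i => \big[And/Top]_(j < n.+1 | val j != i)
                   And (Box (a (i, val j))) (Neg (a (val j, i)))).
  move=> i i_n; have bY := world_boolean (y i).
  apply/(boolean_bigAnd bY) => j /eqP ji.
  have jn : j <= n by rewrite -ltnS.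
  apply/(boolean_And bY); split.
    exact: (ha (i, val j) i_n jn (nesym ji)).1.
  exact/(boolean_Neg bY)/(ha (val j, i) jn i_n ji).2.
move=> i j z z' i_n jn ij.
move/(boolean_bigAnd (world_boolean z))/(_ (Ordinal (jn : j < n.+1))).
move=> /(_ (introN eqP (nesym ij)))/(boolean_And (world_boolean z))[zB _].
move/(boolean_bigAnd (world_boolean z'))/(_ (Ordinal (i_n : i < n.+1))).
move=> /(_ (introN eqP ij))/(boolean_And (world_boolean z'))[_].
by move=> /(boolean_Neg (world_boolean z')) zN /(_ _ zB).
Qed.

End Canonical.

(** * Clusters, depth and width of a preorder *)

Section Clusters.
Variables (W : eqType) (R : W -> W -> Prop).

Definition cluster (x y : W) : Prop := R x y /\ R y x.

Definition covers (s : seq W) (A : set W) : Prop :=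
  {in s, forall z, A z} /\ forall x, A x -> exists2 z, z \in s & cluster x z.

(** Depth at most [k] means that [deep k] fails everywhere: [j] counts strict steps, not points. *)
Fixpoint deep (j : nat) (x : W) : Prop :=
  if j is j'.+1 then exists y, [/\ R x y, ~ R y x & deep j' y] else True.

Fixpoint zigzag (j : nat) (x : W) : set W :=
  if j is j'.+1 then [set y | exists2 z, zigzag j' x z & R z y \/ R y z]
  else [set x].

Definition width_le (A : set W) (t : nat) : Prop :=
  forall y : nat -> W, (forall i, i <= t -> A (y i)) ->
  exists i j, [/\ i <= t, j <= t, i <> j & R (y i) (y j)].

(** Greedy choice: as long as the chosen points do not represent every cluster of [A], one from a
    new cluster is added. *)
Lemma independent_or_cover (A : set W) (t : nat) :
  (exists2 y : nat -> W, forall i, i <= t -> A (y i) &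
     forall i j, i < j <= t -> ~ cluster (y j) (y i)) \/
  (exists2 s, size s <= t & covers s A).
Proof.
elim: t => [|t [[y Ay yN]|[s st cs]]].
- have [[x Ax]|A0] := EM (exists x, A x).
    left; exists (fun=> x) => // i j; rewrite leqn0 => /andP[ij /eqP j0].
    by rewrite j0 in ij.
  by right; exists [::] => //; split=> // x Ax; case: A0; exists x.
- pose s := mkseq y t.+1.
  have [sA|sA] := EM (forall x, A x -> exists2 z, z \in s & cluster x z).
    right; exists s; first by rewrite size_mkseq.
    split=> // z /(nthP z)[i]; rewrite size_mkseq => it <-.
    by rewrite nth_mkseq //; exact: Ay.
  move/existsNP: sA => [x /not_implyP[Ax xs]]; left.
  exists (fun i => if i == t.+1 then x else y i) => [i|i j].
    by case: eqP => // /eqP ni it; apply: Ay; rewrite -ltnS ltn_neqAle ni.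
  move=> /andP[ij jt]; have it : i < t.+1 by exact: leq_trans ij jt.
  rewrite (ltn_eqF it); case: eqP => [_ xi|/eqP nj].
    by apply: xs; exists (y i) => //; apply/mapP; exists i; rewrite ?mem_iota.
  by apply: yN; rewrite ij -ltnS ltn_neqAle nj.
- by right; exists s => //; exact: leqW.
Qed.

Hypothesis Rtrans : forall x y z, R x y -> R y z -> R x z.
Hypothesis Rrefl : forall x, R x x.

(** Related points on one level share a cluster, since a strict step would make the first of them
    deeper. Points from distinct clusters thus form an antichain. *)
Lemma cover_level (A : set W) t j : width_le A t ->
  exists2 s, size s <= t &
    covers s [set x | [/\ A x, deep j x & ~ deep j.+1 x]].
Proof.
move=> wA.
have [[y Ay yN]|//] :=
  independent_or_cover [set x | [/\ A x, deep j x & ~ deep j.+1 x]] t.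
have [i it|i [i' [it i't ii' yy]]] := wA y; first by have [] := Ay i it.
have yy' : R (y i') (y i).
  apply: contrapT => n; have [_ _] := Ay i it; apply; exists (y i').
  by split=> //; have [] := Ay i' i't.
case: (ltngtP i i') => [lt|lt|//].
  by case: (yN i i'); rewrite ?lt.
by case: (yN i' i); rewrite ?lt.
Qed.

Lemma covers_setU s s' (A B : set W) :
  covers s A -> covers s' B -> covers (s ++ s') (A `|` B).
Proof.
move=> [sA cA] [sB cB]; split=> [z|x [/cA|/cB] [z zs xz]].
- by rewrite mem_cat => /orP[/sA|/sB]; [left|right].
- by exists z; rewrite // mem_cat zs.
- by exists z; rewrite // mem_cat zs orbT.
Qed.

Lemma cover_shallow (A : set W) t j : width_le A t ->
  exists2 s, size s <= j * t & covers s [set x | A x /\ ~ deep j x].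
Proof.
move=> wA; elim: j => [|j [s sj cs]].
  by exists [::] => //; split=> // x [_ /(_ I)].
have [s' st cs'] := cover_level j wA.
exists (s ++ s'); first by rewrite size_cat mulSn addnC leq_add.
have -> : [set x | A x /\ ~ deep j.+1 x] = [set x | A x /\ ~ deep j x] `|`
    [set x | [/\ A x, deep j x & ~ deep j.+1 x]].
  apply/seteqP; split=> x.
    by move=> [Ax nx]; have [|] := EM (deep j x); [right|left].
  move=> [[Ax nx]|[//]]; split=> //.
  elim: j x nx {Ax s sj cs s' st cs'} => [x /(_ I)//|j IH x nx [y [xy nyx dy]]].
  apply: nx; exists y; split=> //; apply: contrapT => /IH; exact.
exact: covers_setU.
Qed.

(** A point sees at most [k * n] clusters and is seen from at most [k * m]. By transitivity a point
    may be replaced by its representative, so each step multiplies the bound by [k * (n + m)]. *)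
Lemma cover_zigzag k n m j x :
    (forall x, ~ deep k x) -> (forall x, width_le [set y | R x y] n) ->
    (forall x, width_le [set y | R y x] m) ->
  exists2 s, size s <= (k * (n + m)) ^ j & covers s (zigzag j x).
Proof.
move=> dk wn wm.
have near z : exists s, size s <= k * (n + m) /\
    covers s ([set y | R z y] `|` [set y | R y z]).
  have [s sn cs] := cover_shallow k (wn z).
  have [s' sm cs'] := cover_shallow k (wm z).
  exists (s ++ s'); split; first by rewrite size_cat mulnDr leq_add.
  have h (A : set W) : [set x | A x /\ ~ deep k x] = A.
    by apply/seteqP; split=> y => [[]|Ay] //; split.
  by have := covers_setU cs cs'; rewrite !h.
have /choice[g hg] := near.
elim: j => [|j [s sj [sA cs]]].
  exists [:: x] => //; split=> [z|y ->]; first by rewrite inE => /eqP->.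
  by exists x; rewrite ?inE.
exists (flatten [seq g z | z <- s]); last split.
- rewrite expnS; apply: leq_trans (leq_mul (leqnn _) sj).
  elim: s {sj sA cs} => //= z s IH.
  by rewrite size_cat mulnS leq_add //; exact: (hg z).1.
- move=> y /flatten_mapP[z zs yg]; exists z; first exact: sA.
  exact: (hg z).2.1.
- move=> y [z /cs[z' z's [zz' z'z]] zy].
  have [|u ug yu] := (hg z').2.2 y.
    by case: zy => h; [left|right]; [exact: Rtrans h|exact: Rtrans zz'].
  by exists u => //; apply/flatten_mapP; exists z'.
Qed.

(** Redundant representatives are discarded, so that positions in the list correspond to
    clusters. *)
Lemma cover_independent s (A : set W) : covers s A ->
  exists s', [/\ size s' <= size s, covers s' A &
    forall i j x0, i < size s' -> j < size s' ->
      cluster (nth x0 s' i) (nth x0 s' j) -> i = j].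
Proof.
move=> [sA cs].
have [p [ps pA pN]] : exists p, [/\ size p <= size s,
    {in s, forall z, exists2 u, u \in p & cluster z u} /\ {subset p <= s} &
    forall i j x0, i < size p -> j < size p ->
      cluster (nth x0 p i) (nth x0 p j) -> i = j].
  elim: s {sA cs} => [|z s [p [ps [cp sp] pN]]]; first by exists [::].
  have [[u up zu]|nz] := EM (exists2 u, u \in p & cluster z u).
    exists p; split=> //; first exact: leqW.
    split=> [v|v /sp]; rewrite inE; last by move=> ->; rewrite orbT.
    by move=> /orP[/eqP->|/cp//]; exists u.
  exists (z :: p); split=> //.
    split=> v; rewrite !inE => /orP[/eqP->|]; rewrite ?eqxx //.
    - by exists z; rewrite ?inE ?eqxx.
    - by move/cp=> [u up vu]; exists u; rewrite // inE up orbT.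
    - by move/sp->; rewrite orbT.
  move=> [|i] [|j] x0 //=; rewrite ?ltnS => ip jp c.
  - by case: nz; exists (nth x0 p j) => //; exact: mem_nth.
  - by case: nz; exists (nth x0 p i); [exact: mem_nth|case: c].
  - by congr _.+1; apply: (pN _ _ x0).
exists p; split=> //; split=> [z /pA.2/sA//|x /cs[z zs [xz zx]]].
have [u up [zu uz]] := pA.1 z zs; exists u => //.
by split; [exact: Rtrans zu|exact: Rtrans zx].
Qed.

End Clusters.

(** * Depth, width and z-degree of the canonical frame *)

Lemma eq_subst_bd j s s' :
  (forall i, i < j -> s i = s' i) -> subst s (bd j) = subst s' (bd j).
Proof.
elim: j => [//|[_ h|j IH h]]; first by rewrite /= !h.
change (Imp (Dia (And (Box (s j.+1)) (Neg (subst s (bd j.+1))))) (s j.+1) =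
  Imp (Dia (And (Box (s' j.+1)) (Neg (subst s' (bd j.+1))))) (s' j.+1)).
by rewrite IH ?h // => i ij; apply/h/leqW.
Qed.

Section CanonicalFrame.
Variables (Lam : set form) (nL : normal Lam).

Local Notation pt := (world Lam).

Definition inst (a : form) : Prop :=
  forall (x : pt) s, holds x (subst s a).

Lemma acc_refl : inst (Imp (Box (Var 0)) (Var 0)) -> forall x : pt, acc x x.
Proof.
move=> h x a; apply/(boolean_Imp (world_boolean x)).
exact: (h x (fun=> a)).
Qed.

Lemma acc_trans : inst (Imp (Box (Var 0)) (Box (Box (Var 0)))) ->
  forall x y z : pt, acc x y -> acc y z -> acc x z.
Proof.
move=> h x y z xy yz a xa; apply/yz/xy; move: xa.
by apply/(boolean_Imp (world_boolean x)); exact: (h x (fun=> a)).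
Qed.

(** A strict chain from [x] yields a substitution refuting [bd k]: its first step, to [y], gives a
    formula boxed at [y] and false at [x], which is assigned to the outermost variable. *)
Lemma inst_bd k : 0 < k -> inst (bd k) -> forall x : pt, ~ deep (@acc Lam) k x.
Proof.
case: k => // k _ bdk x dx.
suff [s] : exists s, ~ holds x (subst s (bd k.+1)) by apply; apply: bdk.
have gap (y z : pt) : ~ acc z y -> exists2 a, z (Box a) & ~ y a.
  move=> zy; apply: contrapT => h; apply: zy => a za.
  by apply: contrapT => ya; apply: h; exists a.
elim: k x dx {bdk} => [|k IH] x [y [xy /gap[a ya xa] dy]].
  exists (fun=> a); move/(boolean_Imp (world_boolean x)); apply: contra_not xa.
  by apply; apply/(world_Dia nL); exists y.
(* The variable [k.+1] does not occur in [bd k.+1], so the refutation found at [y] is unaffected. *)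
have [s ys] := IH y dy; exists (fun i => if i == k.+1 then a else s i).
set s' := fun i => _.
have e : subst s' (bd k.+1) = subst s (bd k.+1).
  by apply: eq_subst_bd => i ik; rewrite /s' (ltn_eqF ik).
have ea : s' k.+1 = a by rewrite /s' eqxx.
change (~ holds x (Imp (Dia (And (Box (s' k.+1)) (Neg (subst s' (bd k.+1)))))
  (s' k.+1))).
rewrite e ea => /(boolean_Imp (world_boolean x)) h; apply/xa/h.
apply/(world_Dia nL); exists y => //; apply/(boolean_And (world_boolean y)).
by split=> //; apply/(boolean_Neg (world_boolean y)).
Qed.

Hypothesis refl : forall x : pt, acc x x.

(** Formulas separating an antichain of [n + 1] successors refute an instance of [bw_fwd n];
    reflexivity rules out two of them holding at one world. *)
Lemma inst_bw_fwd n : inst (bw_fwd n) ->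
  forall x : pt, width_le (@acc Lam) [set y | acc x y] n.
Proof.
move=> bwn x y xy; apply: contrapT => h.
have [|b yb bN] := @separate_antichain _ n y.
  by move=> i j i_n jn ij yij; apply: h; exists i, j.
have bx := world_boolean_subst b x.
have prem (i : 'I_n.+1) : true -> holds x (subst b (Dia (Var i))).
  move=> _; apply/(world_Dia nL).
  by exists (y i); [apply: xy; rewrite -ltnS|apply: yb; rewrite -ltnS].
have /(boolean_Imp bx)/(_ (proj2 (boolean_bigAnd bx _ _) prem)) := bwn x b.
move/(boolean_bigOr bx) => [i _ /(boolean_bigOr bx)[j /eqP ij]].
move=> /(world_Dia nL)[z xz /(boolean_And (world_boolean z))[zi]].
have ij' : val i <> val j by move=> e; apply/ij/val_inj.
have bNz z' : holds z' (b j) -> ~ acc z z'.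
  by move=> zj; apply: (bN i j) => //; rewrite -ltnS.
move/(boolean_Or (world_boolean z)) => [zj|/(world_Dia nL)[z' zz' z'j]].
  exact: (bNz z zj (@refl z)).
exact: (bNz z' z'j zz').
Qed.

Lemma inst_bw_bwd m : inst (bw_bwd m) ->
  forall x : pt, width_le (@acc Lam) [set y | acc y x] m.
Proof.
move=> bwm x y xy; apply: contrapT => h.
have [|b yb bN] := @separate_antichain _ m y.
  by move=> i j im jm ij yij; apply: h; exists i, j.
have bx := world_boolean_subst b x.
have prem (i : 'I_m.+1) : true -> holds x (subst b (Pst (Var i))).
  move=> _; apply/(world_Pst nL).
  by exists (y i); [apply: xy; rewrite -ltnS|apply: yb; rewrite -ltnS].
have /(boolean_Imp bx)/(_ (proj2 (boolean_bigAnd bx _ _) prem)) := bwm x b.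
move/(boolean_bigOr bx) => [i _ /(boolean_bigOr bx)[j /eqP ij]].
move=> /(world_Pst nL)[z xz /(boolean_And (world_boolean z))[zi]].
have ij' : val j <> val i by move=> e; apply/ij/val_inj.
have bNz z' : holds z' (b j) -> ~ acc z' z.
  by move=> zj; apply: (bN j i) => //; rewrite -ltnS.
move/(boolean_Or (world_boolean z)) => [zj|/(world_Pst nL)[z' zz' z'j]].
  exact: (bNz z zj (@refl z)).
exact: (bNz z' z'j zz').
Qed.

Lemma world_Delta (x : pt) a :
  x (Delta a) <-> exists2 y, acc x y \/ acc y x & y a.
Proof.
have bx := world_boolean x.
rewrite (boolean_Or bx) (boolean_Or bx) (world_Dia nL) (world_Pst nL).
split=> [[xa|[[y xy ya]|[y yx ya]]]|[y [xy|yx] ya]].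
- by exists x => //; left.
- by exists y => //; left.
- by exists y => //; right.
- by right; left; exists y.
- by right; right; exists y.
Qed.

(** [Delta] is the modality of one zigzag step, which may stay in place by reflexivity. *)
Lemma world_iter_Delta j (x : pt) a :
  x (iter j Delta a) <-> exists2 y : pt, zigzag (@acc Lam) j x y & y a.
Proof.
elim: j a => [|j IH] a; first by split=> [xa|[y -> //]]; exists x.
rewrite iterSr IH; split=> [[y xy /world_Delta[z yz za]]|[z [y xy yz] za]].
  by exists z => //; exists y.
by exists y => //; apply/world_Delta; exists z.
Qed.

(* No canonicity argument is needed for [bz]: the ball of radius [l] being
   finite, one formula separates it from any point outside. *)
Lemma inst_bz l (e : seq pt) : inst (bz l) ->
  forall x : pt, (forall y, zigzag (@acc Lam) l x y -> y \in e) ->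
  zigzag (@acc Lam) l.+1 x `<=` zigzag (@acc Lam) l x.
Proof.
move=> bzl x xe y xy; apply: contrapT => nxy.
have [a ya ea] := separate y e.
have e_subst j : subst (fun=> a) (iter j Delta (Var 0)) = iter j Delta a.
  by elim: j => //= j ->.
have /(boolean_Imp (world_boolean x)) h :
    x (Imp (iter l.+1 Delta a) (iter l Delta a)).
  by rewrite -!e_subst; exact: (bzl x (fun=> a)).
have /world_iter_Delta[z xz za] : x (iter l Delta a).
  by apply/h/world_iter_Delta; exists y.
by apply: (ea z (xe _ xz)) => // zy; rewrite zy in xz.
Qed.

Hypothesis trans : forall x y z : pt, acc x y -> acc y z -> acc x z.

(** Points of one cluster have the same successors and predecessors, so only variables can tell them
    apart. *)
Lemma cluster_ext (x y : pt) : cluster (@acc Lam) x y ->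
  (forall i, x (Var i) <-> y (Var i)) -> x = y.
Proof.
move=> [xy yx] xyV; apply: world_ext.
have bP (z : pt) := world_boolean z.
elim=> [//||a IHa b IHb|a _|a _].
- by split=> [/(bP x).1|/(bP y).1].
- by rewrite (boolean_Imp (bP x)) (boolean_Imp (bP y)) IHa IHb.
- rewrite !(world_Box nL); split=> h z.
    by move=> /(trans xy)/h.
  by move=> /(trans yx)/h.
- rewrite !(world_Pst nL); split=> -[z /trans zx za]; exists z => //.
    exact: zx xy.
  exact: zx yx.
Qed.

Lemma cluster_finite v : (forall (x : pt) i, v <= i -> ~ x (Var i)) ->
  forall x : pt, exists e : seq pt, forall y, cluster (@acc Lam) y x -> y \in e.
Proof.
move=> Vv x.
pose vals (y : pt) := [ffun i : 'I_v => `[< y (Var i) >]].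
have /choice[rep hrep] (f : {ffun 'I_v -> bool}) : exists y : pt,
    (exists2 z, cluster (@acc Lam) z x & vals z = f) ->
    cluster (@acc Lam) y x /\ vals y = f.
  have [[z zx zf]|h] :=
    EM (exists2 z : pt, cluster (@acc Lam) z x & vals z = f).
    by exists z.
  (* A pattern not realised in the cluster is sent to the default [x]; the list only has to contain
     the cluster. *)
  by exists x => /h.
exists [seq rep f | f <- enum {: {ffun 'I_v -> bool}}] => y yx.
have [|[rx xr] ry] := hrep (vals y); first by exists y.
apply/mapP; exists (vals y); first by rewrite mem_enum.
have [yx1 xy1] := yx.
apply: cluster_ext => [|i]; first by split; [exact: trans xr|exact: trans xy1].
have [vi|iv] := leqP v i; first by split=> /Vv; rewrite vi => /(_ isT).
move/ffunP/(_ (Ordinal iv)): ry; rewrite !ffunE /= => ry.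
by split=> /asboolP h; apply/asboolP; [rewrite ry|rewrite -ry].
Qed.

End CanonicalFrame.

(** * Finite model property *)

(* [[set a | L (subst (below v) a)]] is not closed under substitution, but it
   contains all instances of theorems of [L] and refutes every [Var i] with
   [v <= i]. *)
Definition below (v i : nat) : form := if i < v then Var i else Bot.

Lemma normal_below L v :
  tense_logic L -> normal [set a | L (subst (below v) a)].
Proof.
move=> tL; split=> [a ta|a b /= ab|a b] /=.
- exact/(tl_subst tL)/(tl_taut tL).
- exact: (tl_mp tL ab).
- exact: (tl_adj tL).
Qed.

(** [q] projects onto the skeleton [r]; for reflexive [r] each fibre lies in one cluster. Finite
    functions make the skeletons on ['I_d] a finite type. *)
Definition blowup (C : Type) (d : nat) (r : {ffun 'I_d -> {ffun 'I_d -> bool}})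
    (q : C -> 'I_d) : rel C :=
  fun x y => r (q x) (q y).

(** The frame is the connected component of a world refuting [phi] in the canonical frame over the
    variables below [v], with one index of ['I_d] per cluster. *)
Lemma finite_model (L : set form) (k l n m : nat) (phi : form) :
    tense_logic L -> S4BP k l n m `<=` L -> 0 < k -> ~ L phi ->
  exists (d : nat) (r : {ffun 'I_d -> {ffun 'I_d -> bool}}) (C : finType)
    (q : C -> 'I_d),
    [/\ d <= (k * (n + m)) ^ l, (forall i, r i i),
      (forall i, exists x, q x = i), L `<=` Log (blowup r q) & ~ Log (blowup r q) phi].
Proof.
move=> tL SL k0 Lphi.
have [v hv] := subst_finite_support phi.
pose Lam := [set a | L (subst (below v) a)].
have nL : normal Lam := normal_below v tL.
have instL a : L a -> @inst Lam a.
  by move=> La x s; apply: world_Lam; do 2!apply: (tl_subst tL).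
have S4L : S4t `<=` L by move=> a Sa; apply: SL => L' _ + _; exact.
have refl : forall x : world Lam, acc x x.
  by apply/acc_refl/instL/S4L => L' _ _; apply; left.
have trans : forall x y z : world Lam, acc x y -> acc y z -> acc x z.
  by apply/acc_trans/instL/S4L => L' _ _; apply; right.
have ibd : @inst Lam (bd k) by apply/instL/SL => L' _ _; apply; do 3!left.
have ibz : @inst Lam (bz l).
  by apply/instL/SL => L' _ _; apply; do 2!left; right.
have ifwd : @inst Lam (bw_fwd n).
  by apply/instL/SL => L' _ _; apply; left; right.
have ibwd : @inst Lam (bw_bwd m) by apply/instL/SL => L' _ _; apply; right.
have tLam : theory Lam Lam by split=> // a b; exact: (normal_mp nL).
have [|w _ wphi] := @lindenbaum Lam nL Lam phi tLam.
  by rewrite /Lam /= hv // => i iv; rewrite /below iv.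
have [s0 s0N cs0] := cover_zigzag trans refl l w (inst_bd nL k0 ibd)
  (inst_bw_fwd nL refl ifwd) (inst_bw_bwd nL refl ibwd).
have [s [ss0 [sw cs] sN]] := cover_independent trans refl cs0.
have /choice[g hg] : forall x : world Lam, exists e : seq (world Lam),
    forall y, cluster (@acc Lam) y x -> y \in e.
  apply: (cluster_finite nL trans (v := v)) => x i vi.
  have : Lam (Neg (Var i)).
    by rewrite /Lam /= /below ltnNge vi; apply: (tl_taut tL) => u.
  by move/(@world_Lam _ x)/(boolean_Neg (world_boolean x)).
(* The lists [g z] may contain points outside the ball, hence the filter. *)
pose e := [seq x <- flatten [seq g z | z <- s] |
  `[< zigzag (@acc Lam) l w x >]].
have eP y : y \in e <-> zigzag (@acc Lam) l w y.
  rewrite mem_filter; split=> [/andP[/asboolP]//|yl].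
  apply/andP; split; first exact/asboolP.
  by have [z zs yz] := cs y yl; apply/flatten_mapP; exists z => //; exact: hg.
(* By [bz] one more step leads nowhere new, so the ball is a whole component. *)
have e_closed (x y : world Lam) : x \in e -> acc x y \/ acc y x -> y \in e.
  move=> /eP xe xy; apply/eP.
  by apply: (inst_bz nL refl (e := e) ibz) => [z /eP//|]; exists x.
have we : w \in e.
  apply/eP; elim: l {s0N cs0 ss0 sw cs e eP e_closed ibz SL} => // l IH.
  by exists w => //; left.
pose C : finType := seq_sub e; pose h (c : C) : world Lam := ssval c.
have hC y : y \in e -> exists c, h c = y by move=> ye; exists (SeqSub ye).
have he c : h c \in e by exact: ssvalP.
have /choice[q hq] (c : C) :
    exists i : 'I_(size s), cluster (@acc Lam) (h c) (nth w s i).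
  have [z /(nthP w)[i iz <-] hz] := cs _ (proj1 (eP _) (he c)).
  by exists (Ordinal iz).
pose r := [ffun i : 'I_(size s) => [ffun j : 'I_(size s) =>
  `[< acc (nth w s i) (nth w s j) >]]].
have rE : (fun x y => is_true (blowup r q x y)) = (fun x y => acc (h x) (h y)).
  apply/funext => x; apply/funext => y; apply/propext.
  rewrite /blowup !ffunE; have [xq qx] := hq x; have [yq qy] := hq y.
  split=> [/asboolP xy|xy].
    exact: trans xq (trans _ _ _ xy qy).
  by apply/asboolP; exact: trans qx (trans _ _ _ xy yq).
exists (size s), r, C, q; split.
- exact: leq_trans ss0 s0N.
- by move=> i; rewrite !ffunE; apply/asboolP.
- move=> i; have /sw/eP/hC[c ci] : nth w s i \in s by exact: mem_nth.
  exists c; apply/val_inj/(sN _ _ w (ltn_ord _) (ltn_ord _)).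
  by have [] := hq c; rewrite ci; split.
- move=> a /instL La V c; rewrite rE.
  (* The valuation is that of a substitution [t], so validity of [a] reduces to its instances
     holding at all worlds. *)
  have /choice[t ht] (i : nat) :=
    definable [set y | exists2 c, h c = y & V i c] e.
  have -> : V = fun i c => h c (t i).
    apply/funext => i; apply/seteqP; split=> u.
      by move=> Vu; apply/ht => //; exists u.
    by move/ht => /(_ (he u))[u' /val_inj <-].
  apply/(truth_world nL); last exact: La.
    by move=> c' y cy; apply/hC/(e_closed (h c')) => //; left.
  by move=> c' y cy; apply/hC/(e_closed (h c')) => //; right.
- rewrite rE => /(_ (fun i c => h c (Var i)) (SeqSub we)).
  move/(truth_world nL) => H; apply: wphi; rewrite -(subst_Var phi); apply: H.
    by move=> c' y cy; apply/hC/(e_closed (h c')) => //; left.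
  by move=> c' y cy; apply/hC/(e_closed (h c')) => //; right.
Qed.

(** * Tabularity and bounded frames *)

(** Up to isomorphism finitely many frames have at most [M] points; the disjoint union of those
    validating [L] is a finite frame whose logic is [L]. *)
Lemma tabular_of_bounded_frames (L : set form) (M : nat) : consistent L ->
    (forall a, ~ L a -> exists (C : finType) (R : rel C),
      [/\ #|C| <= M, L `<=` Log R & ~ Log R a]) ->
  tabular L.
Proof.
move=> LBot hL.
pose frame := {d : 'I_M.+1 & {ffun 'I_d -> {ffun 'I_d -> bool}}}.
pose I := {u : frame | `[< L `<=` Log (fun i j => tagged u i j) >]}.
pose S (u : I) := 'I_(tag (val u)).
pose W : finType := {u : I & S u}.
pose G : rel W := fun x y =>
  [exists j : S (tag x),
    (y == Tagged S j) && tagged (val (tag x)) (tagged x) j].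
have truthG (u : I) V a (x : S u) :
    truth (fun i j => tagged (val u) i j)
      (fun i => Tagged S (i:=u) @^-1` V i) a x
    <-> truth G V a (Tagged S x).
  apply: truth_morphism => [i j ij|i z /existsP[j /andP[/eqP-> ij]]|i [u' i']].
  - by apply/existsP; exists j; rewrite eqxx.
  - by exists j.
  - case/existsP => /= j /andP[/eqP e ij].
    have uu' : u = u' := congr1 tag e.
    move: j i' ij e; rewrite -uu' => j i' ij /eqP.
    by rewrite eq_Tagged => /eqP /= ->; exists i'.
have small a : ~ L a -> exists (u : I) V (x : S u), ~ truth G V a (Tagged S x).
  move=> /hL[C [R [CM LR Ra]]].
  pose val_C : 'I_#|C| -> C := @enum_val C C.
  pose rho := [ffun i : 'I_#|C| => [ffun j : 'I_#|C| => R (val_C i) (val_C j)]].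
  have lt : #|C| < M.+1 by [].
  have rho_sub : Log (fun i j => rho i j) `<=` Log R.
    apply: (@Log_surj _ _ _ _ val_C) => [i j|z]; first by rewrite !ffunE.
    by exists (enum_rank z); rewrite /val_C enum_rankK.
  have R_sub : Log R `<=` Log (fun i j => rho i j).
    apply: (@Log_surj _ _ _ _ enum_rank) => [x y|i].
      by rewrite !ffunE /val_C !enum_rankK.
    by exists (enum_val i); rewrite enum_valK.
  pose u0 : frame := existT _ (Ordinal lt) rho.
  have hu : `[< L `<=` Log (fun i j => tagged u0 i j) >].
    by apply/asboolP => b /LR/R_sub.
  have /existsNP[V /existsNP[x Vx]] : ~ Log (fun i j => rho i j) a.
    by move/rho_sub.
  pose u : I := exist _ u0 hu.
  exists u, (fun i => [set y : W | exists2 j : S u, V i j & y = Tagged S j]), x.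
  move/truthG => h; apply: Vx.
  suff -> : V = (fun i => Tagged S (i:=u) @^-1`
     [set y : W | exists2 j : S u, V i j & y = Tagged S j]) by [].
  apply/funext => i; apply/seteqP; split=> j; first by exists j.
  by move=> [j' Vj /eqP]; rewrite eq_Tagged => /eqP /= ->.
exists W, G; split.
  by have [u [_ [x _]]] := small Bot LBot; apply/card_gt0P; exists (Tagged S x).
apply/seteqP; split=> [a La V [u x]|a Ga].
  by apply/truthG; move/asboolP: (valP u); apply.
by apply: contrapT => /small[u [V [x]]]; apply; exact: Ga.
Qed.

(** Valid when no point has more than [t] successors, and refuted once [t + 1] successors of a point
    each carry a variable of their own. *)
Definition pigeonhole (t : nat) : form :=
  Imp (\big[And/Top]_(i < t.+1) Dia (Var i))
      (\big[Or/Bot]_(i < t.+1) \big[Or/Bot]_(j < t.+1 | i != j)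
         Dia (And (Var i) (Var j))).

Lemma Log_pigeonhole (W : finType) (R : rel W) : Log R (pigeonhole #|W|).
Proof.
move=> V x; have bx := truth_boolean R V x.
apply/(boolean_Imp bx) => /(boolean_bigAnd bx) h.
have /choice[y hy] (i : 'I_#|W|.+1) : exists y, R x y /\ V i y.
  by have /truth_Dia[y] := h i isT; exists y.
have [i [j [ij yij]]] : exists i j, i <> j /\ y i = y j.
  apply: contrapT => n; have /leq_card : injective y.
    by move=> i j yij; apply: contrapT => ij; apply: n; exists i, j.
  by rewrite card_ord ltnn.
apply/(boolean_bigOr bx); exists i => //.
apply/(boolean_bigOr bx); exists j; first exact/eqP.
have [xi Vi] := hy i; have [xj Vj] := hy j.
apply/truth_Dia; exists (y i) => //.
by apply/(boolean_And (truth_boolean R V (y i))); rewrite /= {2}yij.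
Qed.

(** * Logics of frames with one unbounded cluster *)

Definition fatten (d : nat) (c : 'I_d) (t : nat) (x : 'I_d + 'I_t) : 'I_d :=
  if x is inl i then i else c.

(** The candidates [L(r, c)] among which every consistent pretabular logic is found. *)
Definition limit_logic (d : nat) (r : {ffun 'I_d -> {ffun 'I_d -> bool}})
    (c : 'I_d) : set form :=
  [set a | forall t, Log (blowup r (@fatten d c t)) a].

Lemma tense_limit_logic d r c : tense_logic (@limit_logic d r c).
Proof.
have tL t := tense_Log (blowup r (@fatten d c t)).
split=> [a ta t|a b ab ha t|s a ha t|a b].
- exact: tl_taut (tL t) _ ta.
- exact: (tl_mp (tL t) (ab t)).
- exact: (tl_subst (tL t)).
- by split=> h t; apply/(tl_adj (tL t)).
Qed.

Lemma consistent_limit_logic d r c : consistent (@limit_logic d r c).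
Proof. by move=> /(_ 0 (fun=> set0) (inl c)). Qed.

Lemma limit_logic_not_tabular d (r : {ffun 'I_d -> {ffun 'I_d -> bool}}) c :
  r c c -> ~ tabular (limit_logic r c).
Proof.
move=> rcc [W [R [_ e]]].
have := @Log_pigeonhole W R; rewrite -e => /(_ #|W|.+1) LW.
(* Each of the [#|W|.+1] extra points, successors of [c] by [rcc], carries its own variable and so
   refutes [pigeonhole #|W|]. *)
pose V i : set ('I_d + 'I_#|W|.+1) :=
  [set x | if x is inr j then val j = i else False].
move: (LW V (inl c)) => {LW}; set T := blowup r _.
have bT x := truth_boolean T V x.
move=> /(boolean_Imp (bT _)) h.
have prem (i : 'I_#|W|.+1) : true -> truth T V (Dia (Var i)) (inl c).
  by move=> _; apply/truth_Dia; exists (inr i).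
have /(boolean_bigOr (bT _))[i _] := h (proj2 (boolean_bigAnd (bT _) _ _) prem).
move/(boolean_bigOr (bT _)) => [j /eqP ij /truth_Dia[x _]].
move/(boolean_And (bT x)); case: x => [i'|u] [//= ui uj].
by apply/ij/val_inj; rewrite /= -ui -uj.
Qed.

(** Each fibre collapses to a point, except that [t] points over [c] are kept apart as the extra
    points. One further point over [c] must cover [inl c], whence the strict bound. *)
Lemma Log_blowup_fatten (C : finType) d (r : {ffun 'I_d -> {ffun 'I_d -> bool}})
    (q : C -> 'I_d) (c : 'I_d) t :
    (forall i, exists x, q x = i) -> t < #|[pred x | q x == c]| ->
  Log (blowup r q) `<=` Log (blowup r (@fatten d c t)).
Proof.
move=> qs tc; have [x0 qx0] := qs c.
pose K := [predD1 [pred x | q x == c] & x0].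
have tK : t <= #|K|.
  by move: tc; rewrite (cardD1 x0) inE qx0 eqxx add1n ltnS.
pose g (i : 'I_t) : C := enum_val (widen_ord tK i).
have gK i : g i \in K by exact: enum_valP.
have g_inj : injective g.
  move=> i j /enum_val_inj /(congr1 val) /= ij; exact: val_inj.
pose f x : 'I_d + 'I_t :=
  if [pick i | g i == x] is Some i then inr i else inl (q x).
have qf x : fatten c (f x) = q x.
  rewrite /f; case: pickP => [i /eqP<-|//] /=.
  by have := gK i; rewrite !inE => /andP[_ /eqP].
apply: (@Log_surj _ _ _ _ f) => [x y|[i|i]]; first by rewrite /blowup !qf.
- have [->|ic] := eqVneq i c.
    exists x0; rewrite /f; case: pickP => [j /eqP gj|_]; last by rewrite qx0.
    by have := gK j; rewrite gj !inE eqxx.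
  have [x qx] := qs i; exists x; rewrite /f; case: pickP => [j /eqP gj|_].
    by have := gK j; rewrite gj !inE qx (negbTE ic) andbF.
  by rewrite qx.
- exists (g i); rewrite /f; case: pickP => [j /eqP/g_inj->//|/(_ i)].
  by rewrite eqxx.
Qed.

(** Otherwise each [(r, c)] with [r c c] admits only boundedly many extra points at [c]. Finitely
    many pairs give a common bound on fibres, hence on frames, and [L] is tabular. *)
Lemma limit_logic_above (L : set form) (N : nat) : consistent L ->
    ~ tabular L ->
    (forall a, ~ L a ->
      exists (d : nat) (r : {ffun 'I_d -> {ffun 'I_d -> bool}}) (C : finType)
        (q : C -> 'I_d),
      [/\ d <= N, (forall i, r i i), (forall i, exists x, q x = i),
        L `<=` Log (blowup r q) & ~ Log (blowup r q) a]) ->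
  exists (d : 'I_N.+1) (r : {ffun 'I_d -> {ffun 'I_d -> bool}}) (c : 'I_d),
    r c c /\ L `<=` limit_logic r c.
Proof.
move=> LBot Ltab hL; apply: contrapT => none; apply: Ltab.
pose D := {d : 'I_N.+1 & ({ffun 'I_d -> {ffun 'I_d -> bool}} * 'I_d)%type}.
have /choice[t ht] (u : D) : exists t, (tagged u).1 (tagged u).2 (tagged u).2 ->
    ~ L `<=` Log (blowup (tagged u).1 (@fatten _ (tagged u).2 t)).
  case: u => d [r c] /=; apply: contrapT => h.
  apply: none; exists d, r, c; split.
    (* If [c] is irreflexive the requirement is vacuous and [0] is a default. *)
    by apply: contrapT => nr; apply: h; exists 0.
  move=> a La t; apply: contrapT => nt; apply: h; exists t => _ sub.
  exact/nt/sub.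
pose T := \max_u t u.
apply: (@tabular_of_bounded_frames L (N * T)) => // a /hL.
move=> [d [r [C [q [dN rr qs LC Ca]]]]]; exists C, (blowup r q); split=> //.
(* A larger fibre would make [L] valid on the frame with [t u] extra points, against the choice of
   [t u]. *)
have small c : #|[pred x | q x == c]| <= T.
  rewrite leqNgt; apply/negP => Tc.
  have ltd : d < N.+1 by [].
  pose u : D := existT _ (Ordinal ltd) (r, c).
  apply: (ht u); first exact: rr.
  apply: subset_trans LC _; apply: Log_blowup_fatten => //.
  by apply: leq_ltn_trans Tc; exact: (leq_bigmax u).
have -> : #|C| = \sum_(c < d) #|[pred x | q x == c]|.
  rewrite -sum1_card (partition_big q predT) //=.
  apply: eq_bigr => c _; rewrite -sum1_card.
  by apply: eq_bigl => x; rewrite inE.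
apply: leq_trans (leq_mul dN (leqnn T)).
by rewrite -[X in X * T]card_ord -sum_nat_const; apply: leq_sum => c _.
Qed.

Theorem theorem5p18 (k l n m : nat) :
  0 < k -> 0 < l -> 0 < n -> 0 < m ->
  finite_set (PTAB (S4BP k l n m)).
Proof.
move=> k0 _ _ _; pose N := (k * (n + m)) ^ l.
pose D := {d : 'I_N.+1 & ({ffun 'I_d -> {ffun 'I_d -> bool}} * 'I_d)%type}.
pose lim (u : D) := limit_logic (tagged u).1 (tagged u).2.
(* The singleton accounts for the inconsistent logic. *)
apply: (@sub_finite_set _ _ ([set setT] `|` range lim)); last first.
  rewrite finite_setU; split; first exact: finite_set1.
  by apply: finite_image; exact: finite_finset.
move=> L [[tL Ltab Lpre] SL].
have [LBot|LBot] := EM (L Bot).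
  left; apply/seteqP; split=> // a _; apply: (tl_mp tL) LBot.
  exact: (tl_taut tL).
right; have [|d [r [c [rcc Lrc]]]] := @limit_logic_above L N LBot Ltab.
  by move=> a; exact: finite_model.
exists (existT _ d (r, c)) => //; apply/seteqP; split=> // a ra.
(* Were the inclusion strict, pretabularity would make the [limit_logic] tabular. *)
apply: contrapT => La; apply: (limit_logic_not_tabular rcc).
apply: Lpre; [exact: tense_limit_logic|exact: consistent_limit_logic|].
by split=> // /(_ a ra).
Qed.
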